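(* Let $\alpha>1$, let $0<C_1\le C_2$ be constants, let $K\ge 1$ be a fixed integer, and let $p=\frac{\alpha\ln n}{n}$. Let $G=(V,E)$ be a random graph from $\mathbb{G}(n,p)$ and let $N=(G,c)$ be an electrical network on $G$ whose conductances satisfy $C_1\le c_{ij}\le C_2$ for all $(i,j)\in E$. Let $\Gamma=\{x_1,\dots,x_K\}\subset V$ be a set of $K$ distinct boundary vertices with prescribed boundary potentials $V_{x_k}=p_{x_k}$, where $0\le p_{x_k}\le 1$ for $k=1,\dots,K$. Then with high probability (i.e. with probability $1-o(1)$ as $n\to\infty$) the potential distribution $(V_i)_{i\in V}$ satisfies \[ V_i=\frac{\sum_{k=1}^K p_{x_k}c_{x_k}}{\sum_{k=1}^K c_{x_k}}+O\big((\ln n)^{-1}\big)\qquad\text{for every } i\in V\setminus\Gamma . \]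
   Context: $\mathbb{G}(n,p)$ is the Erdős–Rényi random graph on $n$ vertices in which each of the $\binom n2$ possible edges is present independently with probability $p$. An electrical network $N=(G,c)$ on a connected simple graph $G=(V,E)$ assigns to each edge $(i,j)\in E$ a conductance $c_{ij}=c_{ji}>0$ (the reciprocal of its resistance $r_{ij}$); write $c_i=\sum_{j:(i,j)\in E}c_{ij}$ for the total conductance at vertex $i$. Given a boundary set $\Gamma\subset V$ with prescribed values $V_{x}$ for $x\in\Gamma$, the potential distribution is the function $V:V\to\mathbb{R}$ taking the prescribed values on $\Gamma$ and satisfying Kirchhoff's and Ohm's laws at every non-boundary vertex, i.e. $\sum_{j:(i,j)\in E}c_{ij}(V_i-V_j)=0$ (equivalently $V_i=\sum_{j:(i,j)\in E}\frac{c_{ij}}{c_i}V_j$) for all $i\in V\setminus\Gamma$. The statement is asserted on the event (of probability $1-o(1)$) that $G$ is connected. The implied constant in $O((\ln n)^{-1})$ depends only on $\alpha, C_1,C_2,K$. *)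

(* Defs.v *)
From Stdlib Require Import Reals ClassicalEpsilon.
From mathcomp Require Import all_boot.
Unset Implicit Arguments. Unset Printing Implicit Defensive.
Local Open Scope R_scope.

(* Edge sets of simple graphs on vertex set 'I_n: sets of pairs (i,j) with i<j. *)
Definition upairs (n : nat) : {set 'I_n * 'I_n} :=
  [set e : 'I_n * 'I_n | (nat_of_ord e.1 < nat_of_ord e.2)%N].

Definition adj (n : nat) (E : {set 'I_n * 'I_n}) : rel 'I_n :=
  fun i j => ((i, j) \in E) || ((j, i) \in E).

Definition connected_graph (n : nat) (E : {set 'I_n * 'I_n}) : Prop :=
  forall i j : 'I_n, connect (adj n E) i j.

Definition ind (P : Prop) : R :=
  if excluded_middle_informative P then 1 else 0.

Definition Gnp_prob (n : nat) (p : R) (P : {set 'I_n * 'I_n} -> Prop) : R :=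
  \big[Rplus/0]_(E : {set 'I_n * 'I_n} | E \subset upairs n)
     (p ^ #|E| * (1 - p) ^ (#|upairs n| - #|E|)%N * ind (P E)).

Definition ctot (n : nat) (E : {set 'I_n * 'I_n}) (c : 'I_n -> 'I_n -> R)
  (i : 'I_n) : R :=
  \big[Rplus/0]_(j : 'I_n | adj n E i j) c i j.

Definition is_potential (n K : nat) (E : {set 'I_n * 'I_n})
  (c : 'I_n -> 'I_n -> R) (x : 'I_K -> 'I_n) (pv : 'I_K -> R)
  (V : 'I_n -> R) : Prop :=
  (forall k : 'I_K, V (x k) = pv k) /\
  (forall i : 'I_n, (forall k : 'I_K, x k <> i) ->
     \big[Rplus/0]_(j : 'I_n | adj n E i j) (c i j * (V i - V j)) = 0).

Definition good_graph (Cst C1 C2 : R) (K n : nat) (E : {set 'I_n * 'I_n}) : Prop :=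
  connected_graph n E /\
  forall (c : 'I_n -> 'I_n -> R) (x : 'I_K -> 'I_n) (pv : 'I_K -> R)
         (V : 'I_n -> R),
    (forall i j : 'I_n, c i j = c j i) ->
    (forall i j : 'I_n, adj n E i j -> (C1 <= c i j <= C2)) ->
    injective x ->
    (forall k : 'I_K, (0 <= pv k <= 1)) ->
    is_potential n K E c x pv V ->
    forall i : 'I_n, (forall k : 'I_K, x k <> i) ->
      (Rabs (V i - (\big[Rplus/0]_(k : 'I_K) (pv k * ctot n E c (x k)))
                   / (\big[Rplus/0]_(k : 'I_K) ctot n E c (x k)))
       <= Cst / ln (INR n)).

(* Main.v *)
(** Write L = ln n.  With high probability every vertex set S with
    0 < |S| <= n/2 has at least eps L |S| boundary edges, and all degrees are at
    most D L: both follow from exponential Markov inequalities and union bounds.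
    For S of size at most kap n the bad event has probability at most q^|S| with
    q = n^-(1+gam), and the sum of q^|S| over nonempty S is (1+q)^n - 1; for the
    larger S the crude count 2^n suffices.

    On such a graph let a be a median of the potential V and let M be the maximum
    of |V - a| off the boundary.  Truncating (V - a)^+ and (V - a)^- at height M
    and summing by parts, the truncations have Dirichlet energy O(M L), because
    only the K boundary vertices carry current and each carries O(L).  Cheeger's
    inequality then bounds the sums of their squares by O(M).  Averaging
    harmonicity at a maximizing vertex and using Cauchy-Schwarz over its
    neighbours (at least eps L of them, at most K on the boundary) gives
    M <= O(1/L) + M/2, hence M = O(1/L).  Finally the total boundary current
    vanishes, which identifies a with the conductance-weighted mean of the
    boundary potentials up to O(1/L). *)
From HB Require Import structures.
Require Import Defs.
From Stdlib Require Import Reals Lra Lia Psatz ClassicalEpsilon.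
From mathcomp Require Import all_boot zify_ssreflect.
Set Implicit Arguments. Unset Strict Implicit. Unset Printing Implicit Defensive.
Local Open Scope R_scope.


(** * Finite sums and products of reals, and extremal elements of finite types *)

HB.instance Definition _ := Monoid.isComLaw.Build R 0 Rplus
  (fun x y z => esym (Rplus_assoc x y z)) Rplus_comm Rplus_0_l.
HB.instance Definition _ := Monoid.isComLaw.Build R 1 Rmult
  (fun x y z => esym (Rmult_assoc x y z)) Rmult_comm Rmult_1_l.
HB.instance Definition _ := Monoid.isMulLaw.Build R 0 Rmult Rmult_0_l Rmult_0_r.
HB.instance Definition _ := Monoid.isAddLaw.Build R Rmult Rplus
  (fun x y z => Rmult_plus_distr_r x y z) (fun x y z => Rmult_plus_distr_l x y z).

Lemma rsum_le (I : Type) (r : seq I) (P : pred I) (F G : I -> R) :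
  (forall i, P i -> F i <= G i) ->
  \big[Rplus/0]_(i <- r | P i) F i <= \big[Rplus/0]_(i <- r | P i) G i.
Proof.
move=> FG; elim/big_rec2: _ => [|i x y Pi xy]; first lra.
by have := FG i Pi; lra.
Qed.

Lemma rsum_ge0 (I : Type) (r : seq I) (P : pred I) (F : I -> R) :
  (forall i, P i -> 0 <= F i) -> 0 <= \big[Rplus/0]_(i <- r | P i) F i.
Proof.
move=> F0; elim/big_rec: _ => [|i x Pi x0]; first lra.
by have := F0 i Pi; lra.
Qed.

Lemma rsum_abs_le (I : Type) (r : seq I) (P : pred I) (F : I -> R) :
  Rabs (\big[Rplus/0]_(i <- r | P i) F i)
    <= \big[Rplus/0]_(i <- r | P i) Rabs (F i).
Proof.
elim/big_rec2: _ => [|i x y Pi xy]; first by rewrite Rabs_R0; lra.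
by have := Rabs_triang (F i) y; lra.
Qed.

Lemma rsumB (I : Type) (r : seq I) (P : pred I) (F G : I -> R) :
  \big[Rplus/0]_(i <- r | P i) (F i - G i) =
  \big[Rplus/0]_(i <- r | P i) F i - \big[Rplus/0]_(i <- r | P i) G i.
Proof.
elim: r => [|i r IH]; first by rewrite !big_nil; lra.
by rewrite !big_cons IH; case: (P i) => //; lra.
Qed.

Lemma rsum_const (I : finType) (P : pred I) (c : R) :
  \big[Rplus/0]_(i | P i) c = INR #|P| * c.
Proof.
rewrite big_const; elim: #|P| => [|m IH]; first by rewrite /=; lra.
by rewrite iterS IH S_INR; lra.
Qed.

Lemma rprod_const (I : finType) (P : pred I) (c : R) :
  \big[Rmult/1]_(i | P i) c = c ^ #|P|.
Proof. by rewrite big_const; elim: #|P| => [|m IH] //=; rewrite IH. Qed.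

Lemma rsum_ge_term (I : finType) (P : pred I) (F : I -> R) i :
  P i -> (forall j, P j -> 0 <= F j) -> F i <= \big[Rplus/0]_(j | P j) F j.
Proof.
move=> Pi F0; rewrite (bigD1 i) //=.
have : 0 <= \big[Rplus/0]_(j | P j && (j != i)) F j.
  by apply: rsum_ge0 => j /andP[Pj _]; apply: F0.
by lra.
Qed.

Lemma rsum_sub_le (I : finType) (P Q : pred I) (F : I -> R) :
  (forall i, P i -> Q i) -> (forall i, Q i -> 0 <= F i) ->
  \big[Rplus/0]_(i | P i) F i <= \big[Rplus/0]_(i | Q i) F i.
Proof.
move=> PQ F0; rewrite (bigID P Q) /=.
rewrite [X in X + _](eq_bigl P); last first.
  by move=> i; apply: andb_idl => /PQ.
have : 0 <= \big[Rplus/0]_(i | Q i && ~~ P i) F i.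
  by apply: rsum_ge0 => i /andP[/F0].
by lra.
Qed.

Lemma fin_argmax (I : finType) (P : pred I) (f : I -> R) i0 :
  P i0 -> exists2 i, P i & forall j, P j -> f j <= f i.
Proof.
move=> Pi0.
suff /(_ (enum I)) [i Pi fi] : forall s : seq I,
    exists2 i, P i & forall j, j \in s -> P j -> f j <= f i.
  by exists i => // j; apply: fi; rewrite mem_enum.
elim=> [|k s [i Pi fi]]; first by exists i0.
case Pk: (P k); last first.
  by exists i => // j; rewrite inE => /orP[/eqP-> | /fi//]; rewrite Pk.
case: (Rle_dec (f i) (f k)) => [ik | /Rnot_le_lt ki].
- exists k => // j; rewrite inE => /orP[/eqP-> _ | js Pj]; first lra.
  by have := fi j js Pj; lra.
- exists i => // j; rewrite inE => /orP[/eqP-> _ | js Pj]; first lra.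
  exact: fi.
Qed.

Lemma fin_argmin (I : finType) (P : pred I) (f : I -> R) i0 :
  P i0 -> exists2 i, P i & forall j, P j -> f i <= f j.
Proof.
move=> /(@fin_argmax _ _ (fun i => - f i)) [i Pi fi].
by exists i => // j /fi; lra.
Qed.

(** * Level sets and medians *)

Definition Rltb (x y : R) : bool := if Rlt_dec x y then true else false.

Lemma RltbP x y : reflect (x < y) (Rltb x y).
Proof. by rewrite /Rltb; case: Rlt_dec => xy; constructor. Qed.

Definition above (T : finType) (V : T -> R) (a : R) : {set T} :=
  [set i | Rltb a (V i)].

(** Take the least value with at most half of the vertices strictly above it. The next smaller value
    [V w] has more than half above it, so fewer than half lie at or below [V w], and these include
    all vertices below [V v]. *)
Lemma exists_median (T : finType) (V : T -> R) (t0 : T) :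
  exists a : R, (2 * #|[set i | Rltb a (V i)]| <= #|T|)%N /\
                (2 * #|[set i | Rltb (V i) a]| <= #|T|)%N.
Proof.
pose up v := #|[set i | Rltb (V v) (V i)]|.
have [m _ mmax] := @fin_argmax T predT V t0 isT.
have upm : (2 * up m <= #|T|)%N.
  suff -> : up m = 0%N by rewrite muln0.
  apply: eq_card0 => i; rewrite !inE; apply/negbTE/RltbP.
  by have := mmax i isT; lra.
have [v upv vmin] := @fin_argmin T (fun v => (2 * up v <= #|T|)%N) V m upm.
exists (V v); split; first exact: upv.
have [w0 wv0|none] := pickP (fun w => Rltb (V w) (V v)); last first.
  rewrite [X in (2 * X)%N](_ : _ = 0%N) ?muln0 //.
  by apply: eq_card0 => i; rewrite inE none.
have [w /RltbP wv wmax] := @fin_argmax T (fun w => Rltb (V w) (V v)) V w0 wv0.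
have upw : (#|T| < 2 * up w)%N.
  by rewrite ltnNge; apply/negP => /vmin; lra.
have : (#|[set i | Rltb (V i) (V v)]| <= #|~: [set i | Rltb (V w) (V i)]|)%N.
  apply: subset_leq_card; apply/subsetP => i; rewrite !inE => /wmax iw.
  by apply/negP => /RltbP; lra.
have := cardsC [set i | Rltb (V w) (V i)]; rewrite /up in upw.
by lia.
Qed.

(** * Edge sums, edge expansion and Cheeger's inequality *)

Section Network.

Variables (T : finType) (A : rel T).
Hypothesis A_sym : symmetric A.

(** Ordered pairs are summed: for symmetric [A] an edge between distinct vertices counts once per
    orientation, whereas [cut] keeps only the outward one. *)
Definition esum (F : T -> T -> R) : R :=
  \big[Rplus/0]_i \big[Rplus/0]_(j | A i j) F i j.

Definition cut (S : {set T}) : {set T * T} :=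
  [set e | [&& e.1 \in S, e.2 \notin S & A e.1 e.2]].

Definition degree (i : T) : nat := #|[pred j | A i j]|.

Lemma esum_le F G :
  (forall i j, A i j -> F i j <= G i j) -> esum F <= esum G.
Proof.
by move=> FG; apply: rsum_le => i _; apply: rsum_le => j; apply: FG.
Qed.

Lemma esumD F G : esum (fun i j => F i j + G i j) = esum F + esum G.
Proof.
by rewrite /esum -big_split; apply: eq_bigr => i _; rewrite big_split.
Qed.

Lemma esumZ a F : esum (fun i j => a * F i j) = a * esum F.
Proof.
by rewrite /esum big_distrr; apply: eq_bigr => i _; rewrite big_distrr.
Qed.

Lemma eq_esum F G :
  (forall i j, A i j -> F i j = G i j) -> esum F = esum G.
Proof.
by move=> FG; apply: eq_bigr => i _; apply: eq_bigr => j; apply: FG.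
Qed.

Lemma esum_swap F : esum F = esum (fun i j => F j i).
Proof.
rewrite /esum (exchange_big_dep predT) //=.
by apply: eq_bigr => i _; apply: eq_bigl => j; rewrite A_sym.
Qed.

Lemma INR_cut S :
  INR #|cut S| = esum (fun i j => if (i \in S) && (j \notin S) then 1 else 0).
Proof.
have -> : INR #|cut S| = \big[Rplus/0]_(e in cut S) 1.
  by rewrite rsum_const Rmult_1_r.
rewrite big_mkcond /esum.
under [RHS]eq_bigr => i _ do rewrite big_mkcond.
rewrite pair_bigA /=; apply: eq_bigr => -[i j] _; rewrite inE /=.
by case: (i \in S); case: (j \in S); case: (A i j).
Qed.

Definition expanding (b : R) : Prop :=
  forall S : {set T}, S != set0 -> (2 * #|S| <= #|T|)%N ->
    b * INR #|S| <= INR #|cut S|.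

(* Induction on the support of [h]: subtracting the least positive value of
   [h] from its support removes one level set. *)
Lemma coarea b (h : T -> R) :
  expanding b -> (forall i, 0 <= h i) -> (2 * #|above h R0| <= #|T|)%N ->
  b * \big[Rplus/0]_i h i <= esum (fun i j => Rmax 0 (h i - h j)).
Proof.
move=> exp; have [m] := ubnP #|above h R0|.
elim: m h => // m IH h hm h0 half.
set S := above h 0 in hm half *.
have [S0|Sn0] := eqVneq S set0.
  rewrite big1; last first.
    move=> i _; have : i \notin S by rewrite S0 inE.
    by rewrite inE => /RltbP; have := h0 i; lra.
  rewrite Rmult_0_r; apply: rsum_ge0 => i _; apply: rsum_ge0 => j _.
  exact: Rmax_l.
have /set0Pn [i0 i0S] := Sn0.
have [k kS kmin] := @fin_argmin T (fun i => i \in S) h i0 i0S.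
have hk : 0 < h k by move: kS; rewrite inE => /RltbP.
pose h' i := h i - (if i \in S then h k else 0).
have hS i : i \notin S -> h i = 0.
  by rewrite inE => /RltbP; have := h0 i; lra.
have h'0 i : 0 <= h' i.
  rewrite /h'; case: ifPn => [iS|_]; last by have := h0 i; lra.
  by have := kmin i iS; lra.
have S'S : above h' 0 \subset S :\ k.
  apply/subsetP => i; rewrite !inE => /RltbP; rewrite /h'.
  case: ifPn => [iS|/hS ->]; last by lra.
  move=> hi; apply/andP; split; last by apply/RltbP; lra.
  by apply: contraPneq hi => ->; lra.
have card' := subset_leq_card S'S.
have ltS : (#|S :\ k| < #|S|)%N by rewrite [#|S|](cardsD1 k) kS.
have := IH h' _ h'0 _.
(* Lowering [h] on [S] by its minimum [h k] there keeps differences within [S] and shortens each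
   drop out of [S] by exactly [h k]. *)
have -> : esum (fun i j => Rmax 0 (h i - h j)) =
    esum (fun i j => Rmax 0 (h' i - h' j)) + h k * INR #|cut S|.
  rewrite INR_cut -esumZ -esumD; apply: eq_esum => i j _; rewrite /h'.
  have [iS|/hS hi] := boolP (i \in S); have [jS|/hS hj] := boolP (j \in S) => /=.
  - by rewrite Rmult_0_r Rplus_0_r; congr Rmax; lra.
  - have := kmin i iS; rewrite hj => ?.
    by rewrite !Rmax_right; lra.
  - by have := kmin j jS; rewrite hi => ?; rewrite !Rmax_left; lra.
  - by rewrite hi hj Rmult_0_r Rplus_0_r; congr Rmax; lra.
have -> : \big[Rplus/0]_i h i = \big[Rplus/0]_i h' i + h k * INR #|S|.
  have -> : h k * INR #|S| = \big[Rplus/0]_i (if i \in S then h k else 0).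
    by rewrite -big_mkcond rsum_const Rmult_comm.
  by rewrite -big_split /=; apply: eq_bigr => i _; rewrite /h'; lra.
have := exp S Sn0 half.
move=> expS IH'.
have : b * \big[Rplus/0]_i h' i <= esum (fun i j => Rmax 0 (h' i - h' j)).
  apply: IH'.
  - by apply: leq_ltn_trans card' _; apply: leq_trans ltS _; rewrite -ltnS.
  - by apply: leq_trans half; rewrite leq_mul2l (leq_trans card') ?orbT // ltnW.
by nra.
Qed.

(** [coarea] is applied to [g ^ 2], whose increments factor as (g i - g j)(g i + g j). The AM-GM
    weights are such that the sums [g i + g j] use up half of the left side and are absorbed. *)
Lemma cheeger b D (g : T -> R) :
  0 < b -> 0 < D -> expanding b -> (forall i, INR (degree i) <= D) ->
  (forall i, 0 <= g i) -> (2 * #|above g R0| <= #|T|)%N ->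
  b ^ 2 * \big[Rplus/0]_i (g i) ^ 2 <= 4 * D * esum (fun i j => (g i - g j) ^ 2).
Proof.
move=> b0 D0 exp degD g0 half.
have := @coarea b (fun i => g i ^ 2) exp (fun i => pow2_ge_0 (g i)) _.
have -> : above (fun i => g i ^ 2) R0 = above g R0.
  apply/setP => i; rewrite !inE; apply/RltbP/RltbP; have := g0 i; last by nra.
  by case=> [//|<-]; lra.
move=> /(_ half).
set G := \big[Rplus/0]_i _; set E := esum (fun i j => (g i - g j) ^ 2).
set H := esum _ => HG.
have sq_le : esum (fun i j => (g i + g j) ^ 2) <= 4 * (D * G).
  apply: (Rle_trans _ (esum (fun i j => 2 * g i ^ 2 + 2 * g j ^ 2))).
    by apply: esum_le => i j _; have := pow2_ge_0 (g i - g j); lra.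
  rewrite esumD !esumZ -(esum_swap (fun i j => g i ^ 2)).
  suff : esum (fun i j => g i ^ 2) <= D * G by lra.
  rewrite big_distrr; apply: rsum_le => i _; rewrite rsum_const.
  by apply: Rmult_le_compat_r; [apply: pow2_ge_0 | apply: degD].
have HE : 8 * D * b * H
    <= 16 * D ^ 2 * E + b ^ 2 * esum (fun i j => (g i + g j) ^ 2).
  rewrite /E -!esumZ -esumD; apply: esum_le => i j _.
  (* AM-GM: [8 D b x y <= 16 D^2 x^2 + b^2 y^2] *)
  rewrite /Rmax; case: Rle_dec => _.
    by have := pow2_ge_0 (4 * D * (g i - g j) - b * (g i + g j)); nra.
  by have := pow2_ge_0 (D * (g i - g j)); have := pow2_ge_0 (b * (g i + g j)); nra.
have b2 : 0 < b ^ 2 by nra.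
have DbG : 8 * D * b * (b * G) <= 8 * D * b * H.
  by apply: Rmult_le_compat_l HG; nra.
have := Rmult_le_compat_l (b ^ 2) _ _ (Rlt_le _ _ b2) sq_le.
move=> le1; apply: (Rmult_le_reg_l (4 * D)); first lra.
by nra.
Qed.

(** * Currents, Dirichlet energy and harmonic potentials *)

Variable c : T -> T -> R.
Hypothesis c_sym : forall i j, c i j = c j i.

Definition current (V : T -> R) (i : T) : R :=
  \big[Rplus/0]_(j | A i j) (c i j * (V i - V j)).

(** Discrete Green identity: swapping the ends of each edge pairs [g i] with [- g j], and the 2
    reflects both orientations. *)
Lemma current_by_parts (V g : T -> R) :
  2 * \big[Rplus/0]_i (g i * current V i)
    = esum (fun i j => c i j * ((V i - V j) * (g i - g j))).
Proof.
have -> : \big[Rplus/0]_i (g i * current V i)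
    = esum (fun i j => g i * (c i j * (V i - V j))).
  by apply: eq_bigr => i _; rewrite big_distrr.
set X := esum _; suff : esum (fun i j => c i j * ((V i - V j) * (g i - g j)))
   = X + esum (fun i j => g j * (c j i * (V j - V i))).
  by rewrite -(esum_swap (fun i j => g i * (c i j * (V i - V j)))) -/X; lra.
by rewrite -esumD; apply: eq_esum => i j _; rewrite (c_sym j i); lra.
Qed.

Variables (C1 C2 : R) (B : {set T}).
Hypothesis C1_gt0 : 0 < C1.
Hypothesis c_bnd : forall i j, A i j -> C1 <= c i j <= C2.

Definition harmonic (V : T -> R) : Prop :=
  forall i, i \notin B -> current V i = 0.

Lemma currentN V i : current (fun j => - V j) i = - current V i.
Proof.
rewrite -[RHS]Rmult_1_l -Ropp_mult_distr_r Ropp_mult_distr_l big_distrr.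
by apply: eq_bigr => j _ /=; lra.
Qed.

Lemma harmonic_sum (V g : T -> R) : harmonic V ->
  \big[Rplus/0]_i (g i * current V i) =
  \big[Rplus/0]_(i in B) (g i * current V i).
Proof.
move=> Vh; rewrite (bigID (mem B)) /= [X in _ + X]big1 ?Rplus_0_r //.
by move=> i /Vh ->; rewrite Rmult_0_r.
Qed.

(** The condition on [g] holds for monotone 1-Lipschitz functions of [V], such as truncations.
    Green's identity then dominates their energy, and harmonicity leaves only boundary currents. *)
Lemma energy_le (V g : T -> R) : harmonic V ->
  (forall i j, (g i - g j) ^ 2 <= (V i - V j) * (g i - g j)) ->
  C1 * esum (fun i j => (g i - g j) ^ 2)
    <= 2 * \big[Rplus/0]_(i in B) (g i * current V i).
Proof.
move=> Vh gV; rewrite -(harmonic_sum g Vh) current_by_parts -esumZ.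
apply: esum_le => i j Aij; have [c1 _] := c_bnd Aij.
by have := gV i j; have := pow2_ge_0 (g i - g j); nra.
Qed.

(** For [0 <= M], the positive part of [x] cut off at height [M]; at [- x] it is the truncated
    negative part. *)
Definition clamp (M x : R) : R := Rmax 0 (Rmin M x).

Lemma clamp_contraction M x y :
  (clamp M x - clamp M y) ^ 2 <= (x - y) * (clamp M x - clamp M y).
Proof.
have mono u v : u <= v -> 0 <= clamp M v - clamp M u <= v - u.
  rewrite /clamp /Rmin => uv.
  by repeat case: Rle_dec => ?; rewrite /Rmax; repeat case: Rle_dec => ?; lra.
by have [/mono|/Rlt_le /mono] := Rle_lt_dec x y; nra.
Qed.

Lemma clamp_abs M x : Rabs x <= M -> Rabs x <= clamp M x + clamp M (- x).
Proof.
move=> xM; have p1 := Rmax_l 0 (Rmin M x); have p2 := Rmax_l 0 (Rmin M (- x)).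
have := Rle_abs x; have := Rle_abs (- x); rewrite Rabs_Ropp => h1 h2.
rewrite {1}/Rabs; case: Rcase_abs => x0.
  suff : - x <= clamp M (- x) by rewrite /clamp; lra.
  by rewrite /clamp Rmin_right; [apply: Rmax_r | lra].
suff : x <= clamp M x by rewrite /clamp; lra.
by rewrite /clamp Rmin_right; [apply: Rmax_r | lra].
Qed.

(** The positive part of [V - a] vanishes on [B], so its energy is zero; it is constant along edges,
    and connectivity spreads the value 0 from a boundary vertex. *)
Lemma max_principle V a : harmonic V ->
  (forall i j, connect A i j) -> B != set0 -> (forall i, i \in B -> V i <= a) ->
  forall i, V i <= a.
Proof.
move=> Vh con /set0Pn [x xB] VB.
pose g i := Rmax 0 (V i - a).
have gB i : i \in B -> g i = 0.
  by move=> /VB Vi; rewrite /g Rmax_left //; lra.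
have gg i j : (g i - g j) ^ 2 <= (V i - V j) * (g i - g j).
  by rewrite /g /Rmax; repeat case: Rle_dec => ?; nra.
have := energy_le Vh gg.
rewrite big1 ?Rmult_0_r; last by move=> i /gB->; rewrite Rmult_0_l.
move=> E0.
have edge i j : A i j -> g i = g j.
  move=> Aij.
  have t0 : (g i - g j) ^ 2 <= esum (fun i j => (g i - g j) ^ 2).
    apply: (Rle_trans _ (\big[Rplus/0]_(j | A i j) (g i - g j) ^ 2)).
      by apply: (@rsum_ge_term _ _ (fun j => (g i - g j) ^ 2)) => // k _;
        apply: pow2_ge_0.
    apply: (@rsum_ge_term _ predT 
      (fun i => \big[Rplus/0]_(j | A i j) (g i - g j) ^ 2)) => // k _.
    by apply: rsum_ge0 => l _; apply: pow2_ge_0.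
  have E_le0 : esum (fun i j => (g i - g j) ^ 2) <= 0 by nra.
  suff : g i - g j = 0 by lra.
  by apply: Rsqr_0_uniq; have := Rle_0_sqr (g i - g j); rewrite /Rsqr; lra.
have gx i : g i = 0.
  have /connectP [p pp ->] := con x i; rewrite -(gB x xB).
  elim: p x {xB} pp => //= y p IH x /andP[/edge-> /IH ->] //.
move=> i; have := gx i; have := Rmax_r 0 (V i - a); rewrite /g; lra.
Qed.


Lemma current_le V i : (forall i j, Rabs (V i - V j) <= 1) ->
  Rabs (current V i) <= C2 * INR (degree i).
Proof.
move=> V1; apply: Rle_trans (rsum_abs_le _ _ _) _.
rewrite Rmult_comm -rsum_const; apply: rsum_le => j /c_bnd [c1 c2].
rewrite Rabs_mult (Rabs_right (c i j)); last lra.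
by have := V1 i j; have := Rabs_pos (V i - V j); nra.
Qed.

(** Each boundary vertex feeds the energy by at most [M] times a current of at most [C2 * D]. The
    resulting bound is linear in [M], which lets [near_constant] absorb it. *)
Lemma clamp_l2 b D M a V :
  0 < b -> 0 < D -> 0 <= M -> expanding b -> (forall i, INR (degree i) <= D) ->
  0 <= C2 -> harmonic V -> (forall i j, Rabs (V i - V j) <= 1) ->
  (2 * #|above V a| <= #|T|)%N ->
  b ^ 2 * C1 * \big[Rplus/0]_i (clamp M (V i - a)) ^ 2
    <= 8 * M * INR #|B| * D ^ 2 * C2.
Proof.
move=> b0 D0 M0 exp degD C20 Vh V1 half.
pose g i := clamp M (V i - a).
have g0 i : 0 <= g i by apply: Rmax_l.
have gM i : g i <= M by apply: Rmax_lub => //; apply: Rmin_l.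
have gg i j : (g i - g j) ^ 2 <= (V i - V j) * (g i - g j).
  by have := clamp_contraction M (V i - a) (V j - a); rewrite -!/(g _); lra.
have halfg : (2 * #|above g R0| <= #|T|)%N.
  apply: leq_trans half; rewrite leq_mul2l; apply/orP; right.
  apply: subset_leq_card; apply/subsetP => i; rewrite !inE => /RltbP gi.
  apply/RltbP; move: gi; rewrite /g /clamp.
  have := Rmin_r M (V i - a); rewrite /Rmax; case: Rle_dec; lra.
have := cheeger b0 D0 exp degD g0 halfg.
have := energy_le Vh gg; set E := esum _ => E1 E2.
have curr : \big[Rplus/0]_(i in B) (g i * current V i)
    <= INR #|B| * (M * (C2 * D)).
  rewrite -rsum_const; apply: rsum_le => i _.
  have := current_le i V1; have := Rle_abs (current V i).
  have := Rmult_le_compat_l C2 _ _ C20 (degD i).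
  move=> h1 h2 h3; apply: Rle_trans (Rmult_le_compat_l _ _ (C2 * D) (g0 i) _) _.
    by lra.
  by apply: Rmult_le_compat_r => //; nra.
rewrite -/g; set G := \big[Rplus/0]_i _ in E2 *.
have : C1 * (b ^ 2 * G) <= C1 * (4 * D * E) by apply: Rmult_le_compat_l; lra.
have : 4 * D * (C1 * E) <= 4 * D * (2 * (INR #|B| * (M * (C2 * D)))).
  by apply: Rmult_le_compat_l; lra.
by lra.
Qed.

Lemma expanding_degree b i : (2 <= #|T|)%N -> expanding b -> b <= INR (degree i).
Proof.
move=> T2 /(_ [set i]); rewrite cards1 Rmult_1_r => exp.
apply: Rle_trans (exp _ _) _; [by apply/set0Pn; exists i; rewrite set11 | by lia |].
apply/le_INR/leP; rewrite /degree.
rewrite -(card_imset [pred j | A i j] (f := fun j => (i, j))); last by move=> j k [].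
apply/subset_leq_card/subsetP => -[j k]; rewrite !inE /= => /and3P[/eqP-> _ Aik].
by apply/imsetP; exists k.
Qed.

(** The component of [i] and its complement have empty cuts, and one of them holds at most half of
    the vertices; expansion forces that one to be empty. *)
Lemma expanding_connected b : 0 < b -> expanding b -> forall i j, connect A i j.
Proof.
move=> b0 exp i j; pose S := [set k | connect A i k].
have closedS k l : A k l -> (k \in S) = (l \in S).
  move=> Akl; rewrite !inE; apply/idP/idP => ik; apply: connect_trans ik _.
    exact: connect1.
  by apply: connect1; rewrite A_sym.
have cut0 : cut S = set0.
  apply/setP => -[k l]; rewrite !inE /=; apply/negP => /and3P[ik il /closedS].
  by rewrite !inE ik (negbTE il).
have cutC0 : cut (~: S) = set0.
  apply/setP => -[k l]; rewrite !inE /=; apply/negP => /and3P[ik il /closedS].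
  by rewrite !inE (negbTE ik) (negbNE il).
have iS : i \in S by rewrite inE.
apply: contraT => ij.
have jS : j \in ~: S by rewrite !inE.
have pos (U : {set T}) : U != set0 -> 0 < b * INR #|U|.
  by rewrite -card_gt0 => U0; apply: Rmult_lt_0_compat => //; apply/lt_0_INR/ltP.
have := cardsC S.
have [le1 _|gt1 cS] := leqP (2 * #|S|) #|T|.
- have S0 : S != set0 by apply/set0Pn; exists i.
  by have := exp S S0 le1; have := pos S S0; rewrite cut0 cards0 /=; lra.
- have S0 : ~: S != set0 by apply/set0Pn; exists j.
  have le2 : (2 * #|~: S| <= #|T|)%N by lia.
  by have := exp _ S0 le2; have := pos _ S0; rewrite cutC0 cards0 /=; lra.
Qed.

Definition conductance (i : T) : R := \big[Rplus/0]_(j | A i j) c i j.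

Lemma current_shift V a i :
  current V i = conductance i * (V i - a) - \big[Rplus/0]_(j | A i j) (c i j * (V j - a)).
Proof. by rewrite big_distrl /= -rsumB; apply: eq_bigr => j _; lra. Qed.

Lemma conductance_ge i : C1 * INR (degree i) <= conductance i.
Proof. by rewrite Rmult_comm -rsum_const; apply: rsum_le => j /c_bnd[]. Qed.

(** A self-improving bound: truncations at the unknown maximum [M] have square sums at most [Q * M],
    so averaging over the neighbours of a maximizer returns half of [M] plus an explicit error over
    [b]. *)
Lemma near_constant b D a V :
  0 < b -> 0 < D -> expanding b -> (forall i, b <= INR (degree i) <= D) ->
  C1 <= C2 -> harmonic V -> B != set0 ->
  (forall i j, Rabs (V i - V j) <= 1) -> (forall i, Rabs (V i - a) <= 1) ->
  (2 * #|above V a| <= #|T|)%N -> (2 * #|above (fun i => - V i) (Ropp a)| <= #|T|)%N ->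
  let Q := 8 * INR #|B| * D ^ 2 * C2 / (b ^ 2 * C1) in
  forall i, i \notin B ->
    Rabs (V i - a) <= 2 * (C2 / C1) * (INR #|B| + 2 * Q * (C2 / C1)) / b.
Proof.
move=> b0 D0 exp deg C12 Vh B0 V1 Va1 up down Q i0 i0B.
have K0 : 0 < INR #|B| by apply/lt_0_INR/ltP; rewrite card_gt0.
have b2 : 0 < b ^ 2 by nra.
have D2 : 0 < D ^ 2 by nra.
have Q0 : 0 < Q.
  by apply: Rdiv_lt_0_compat; last nra; repeat apply: Rmult_lt_0_compat => //; lra.
(* The maximum is taken off [B] only, since boundary values may stay far from [a]. *)
have [i iB imax] := @fin_argmax T (fun i => i \notin B) (fun i => Rabs (V i - a)) i0 i0B.
apply: Rle_trans (imax i0 i0B) _; set M := Rabs (V i - a) in imax *.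
have M0 : 0 <= M by apply: Rabs_pos.
pose gp j := clamp M (V j - a); pose gm j := clamp M (- V j - - a).
have gmp j : j \notin B -> Rabs (V j - a) <= gp j + gm j.
  move/imax/clamp_abs; rewrite /gp /gm.
  by have -> : - (V j - a) = - V j - - a by lra.
have toQ G : b ^ 2 * C1 * G <= 8 * M * INR #|B| * D ^ 2 * C2 -> G <= Q * M.
  move=> le1; apply: (Rmult_le_reg_l (b ^ 2 * C1)); first by nra.
  apply: Rle_trans le1 _; apply: Req_le; rewrite /Q; field.
  by split; lra.
have C20 : 0 <= C2 by lra.
have Sgp : \big[Rplus/0]_j gp j ^ 2 <= Q * M.
  by apply: toQ; apply: (clamp_l2 b0 D0 M0 exp (fun i => proj2 (deg i)) C20 Vh V1 up).
have Sgm : \big[Rplus/0]_j gm j ^ 2 <= Q * M.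
  apply: toQ; apply: (clamp_l2 b0 D0 M0 exp (fun i => proj2 (deg i)) C20 _ _ down).
  - by move=> j jB; rewrite currentN Vh // Ropp_0.
  - by move=> j k; have := V1 k j; congr (Rabs _ <= _); lra.
(* Chosen so that in [lamQ] the quadratic term is exactly [C1 * M / 2], half of the averaged left
   side. *)
pose lam := b * C1 / (4 * Q * C2).
have lam0 : 0 < lam.
  by apply: Rdiv_lt_0_compat; [apply: Rmult_lt_0_compat | nra].
have [bd dD] := deg i; set d := INR (degree i) in bd dD.
(* Weighted AM-GM plays the role of Cauchy-Schwarz: a sum over neighbours becomes square sums plus a
   constant per neighbour. *)
have amgm g : g <= lam * g ^ 2 + / (4 * lam).
  apply: (Rmult_le_reg_l lam) => //; rewrite Rmult_plus_distr_l.
  have -> : lam * / (4 * lam) = / 4 by field; lra.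
  by have := pow2_ge_0 (lam * g - / 2); lra.
have sumf : \big[Rplus/0]_(j | A i j) Rabs (V j - a)
    <= INR #|B| + (lam * (2 * (Q * M)) + d * (2 * / (4 * lam))).
  apply: (Rle_trans _ (\big[Rplus/0]_(j | A i j)
     ((if j \in B then 1 else 0)
       + (lam * (gp j ^ 2 + gm j ^ 2) + 2 * / (4 * lam))))).
    apply: rsum_le => j _; have := amgm (gp j); have := amgm (gm j).
    have := pow2_ge_0 (gp j); have := pow2_ge_0 (gm j).
    have il : 0 < / (4 * lam) by apply: Rinv_0_lt_compat; lra.
    case: ifPn => [_|/gmp]; last by lra.
    by have := Va1 j; nra.
  rewrite !big_split /= rsum_const -/(degree i) -/d; apply: Rplus_le_compat.
    rewrite -[INR #|B|]Rmult_1_r -rsum_const [X in _ <= X]big_mkcond /=.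
    by apply: rsum_sub_le => // j _; case: ifP; lra.
  apply: Rplus_le_compat_r; rewrite -big_distrr; apply: Rmult_le_compat_l; first lra.
  apply: (Rle_trans _ (\big[Rplus/0]_j (gp j ^ 2 + gm j ^ 2))).
    apply: rsum_sub_le => // j _.
    by have := pow2_ge_0 (gp j); have := pow2_ge_0 (gm j); lra.
  by have := Rplus_le_compat _ _ _ _ Sgp Sgm; rewrite -big_split /=; lra.
have avg : C1 * d * M <= C2 * \big[Rplus/0]_(j | A i j) Rabs (V j - a).
  have := Vh i iB; rewrite (current_shift V a) => avg.
  have ci := conductance_ge i; rewrite -/d in ci.
  apply: (Rle_trans _ (Rabs (conductance i * (V i - a)))).
    rewrite Rabs_mult -/M; apply: Rmult_le_compat_r => //.
    by apply: Rle_trans ci _; apply: Rle_abs.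
  have -> : conductance i * (V i - a)
      = \big[Rplus/0]_(j | A i j) (c i j * (V j - a)) by lra.
  apply: Rle_trans (rsum_abs_le _ _ _) _.
  rewrite big_distrr /=; apply: rsum_le => j /c_bnd [c1 c2].
  rewrite Rabs_mult (Rabs_right (c i j)); last lra.
  by apply: Rmult_le_compat_r => //; apply: Rabs_pos.
have d0 : 0 < d by lra.
have {}avg : C1 * M <= C2 * (INR #|B| / b + lam * (2 * (Q * M)) / b + 2 * / (4 * lam)).
  apply: (Rmult_le_reg_l d) => //.
  apply: (Rle_trans _ (C2 * (INR #|B| + (lam * (2 * (Q * M)) + d * (2 * / (4 * lam)))))).
    have := Rmult_le_compat_l _ _ _ C20 sumf; lra.
  have swap X : d * (C2 * X) = C2 * (d * X) by lra.
  rewrite swap; apply: Rmult_le_compat_l => //.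
  have db z : 0 <= z -> z <= d * (z / b).
    move=> z0; apply: (Rmult_le_reg_l b) => //.
    have -> : b * (d * (z / b)) = d * z by field; lra.
    by apply: Rmult_le_compat_r.
  have := db (INR #|B|) (Rlt_le _ _ K0).
  have : 0 <= lam * (2 * (Q * M)) by apply: Rmult_le_pos; nra.
  by move/db; lra.
have lamQ : C2 * (lam * (2 * (Q * M)) / b) = C1 * M / 2.
  by rewrite /lam; field; repeat split; lra.
have lamI : C2 * (2 * / (4 * lam)) = 2 * Q * C2 * (C2 / C1) / b.
  by rewrite /lam; field; repeat split; lra.
apply: (Rmult_le_reg_l (C1 / 2)); first lra.
have -> : C1 / 2 * (2 * (C2 / C1) * (INR #|B| + 2 * Q * (C2 / C1)) / b)
    = C2 * (INR #|B| / b) + 2 * Q * C2 * (C2 / C1) / b.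
  by field; lra.
by lra.
Qed.

(** The boundary imbalance is a sum of [c i j * (V j - a)] over neighbours of boundary vertices.
    Neighbours off [B] cost [M] times their conductance; each boundary vertex has at most [#|B|]
    neighbours in [B], costing at most [C2] each. Then divide by the total boundary conductance. *)
Lemma boundary_average b a M V :
  0 < b -> (forall i, b <= INR (degree i)) -> C1 <= C2 -> harmonic V ->
  B != set0 -> (forall i, Rabs (V i - a) <= 1) -> 0 <= M ->
  (forall i, i \notin B -> Rabs (V i - a) <= M) ->
  Rabs ((\big[Rplus/0]_(i in B) (V i * conductance i))
         / (\big[Rplus/0]_(i in B) conductance i) - a)
    <= C2 / C1 * INR #|B| / b + M.
Proof.
move=> b0 deg C12 Vh B0 Va1 M0 VM.
have K0 : 0 < INR #|B| by apply/lt_0_INR/ltP; rewrite card_gt0.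
set W := \big[Rplus/0]_(i in B) (V i * _); set Ct := \big[Rplus/0]_(i in B) conductance i.
have Ct_ge : INR #|B| * (C1 * b) <= Ct.
  rewrite -rsum_const; apply: rsum_le => i _.
  by apply: Rle_trans (conductance_ge i); apply: Rmult_le_compat_l; [lra|].
have C1b : 0 < C1 * b by apply: Rmult_lt_0_compat.
have Ct0 : 0 < Ct by apply: Rlt_le_trans Ct_ge; apply: Rmult_lt_0_compat.
have flow : W - a * Ct
   = \big[Rplus/0]_(i in B) \big[Rplus/0]_(j | A i j) (c i j * (V j - a)).
  (* Summing by parts against the constant 1 shows that the boundary currents add up to zero. *)
  have := current_by_parts V (fun=> 1); rewrite (harmonic_sum _ Vh).
  rewrite [X in _ = X](_ : _ = 0); last first.
    by apply: big1 => i _; apply: big1 => j _; lra.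
  under eq_bigr => i _ do rewrite (current_shift V a) Rmult_1_l.
  rewrite rsumB.
  suff -> : \big[Rplus/0]_(i in B) (conductance i * (V i - a)) = W - a * Ct by lra.
  by rewrite /W /Ct big_distrr -rsumB /=; apply: eq_bigr => i _; lra.
have flow_le : Rabs (W - a * Ct) <= INR #|B| * (INR #|B| * C2) + M * Ct.
  rewrite flow; apply: Rle_trans (rsum_abs_le _ _ _) _.
  rewrite -rsum_const /Ct big_distrr -big_split /=; apply: rsum_le => i _.
  apply: Rle_trans (rsum_abs_le _ _ _) _.
  apply: (Rle_trans _ (\big[Rplus/0]_(j | A i j)
     ((if j \in B then C2 else 0) + M * c i j))).
    apply: rsum_le => j /c_bnd [c1 c2].
    rewrite Rabs_mult (Rabs_right (c i j)); last lra.
    have := Va1 j; have := Rabs_pos (V j - a).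
    by case: ifPn => [_|/VM]; nra.
  rewrite big_split /= -big_distrr; apply: Rplus_le_compat_r.
  rewrite -rsum_const [X in _ <= X]big_mkcond /=.
  by apply: rsum_sub_le => // j _; case: ifP; lra.
have -> : W / Ct - a = (W - a * Ct) / Ct by field; lra.
rewrite Rabs_mult Rabs_inv (Rabs_right Ct); last lra.
apply: (Rmult_le_reg_r Ct) => //.
have -> : Rabs (W - a * Ct) * / Ct * Ct = Rabs (W - a * Ct) by field; lra.
apply: Rle_trans flow_le _; rewrite Rmult_plus_distr_r; apply: Rplus_le_compat_r.
have := Rmult_le_compat_l (C2 / C1 * INR #|B| / b) _ _ _ Ct_ge.
have -> : C2 / C1 * INR #|B| / b * (INR #|B| * (C1 * b)) = INR #|B| * (INR #|B| * C2).
  by field; lra.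
apply; apply/Rlt_le/Rdiv_lt_0_compat => //; apply: Rmult_lt_0_compat => //.
by apply: Rdiv_lt_0_compat; lra.
Qed.

End Network.

(** * Expander graphs satisfy the potential estimate *)

Lemma adj_sym n (E : {set 'I_n * 'I_n}) : symmetric (adj n E).
Proof. by move=> i j; rewrite /adj orbC. Qed.

(** With L = ln n, interior potentials lie within [M / (eps * L)] of the median, and the boundary
    mean within that plus [C2 / C1 * INR K / (eps * L)]; the triangle inequality adds the two. *)
Lemma expander_good_graph C1 C2 eps D K n (E : {set 'I_n * 'I_n}) :
  0 < C1 -> C1 <= C2 -> 0 < eps -> 0 < D -> (1 <= K)%N -> (2 <= n)%N ->
  0 < ln (INR n) -> expanding (adj n E) (eps * ln (INR n)) ->
  (forall i, INR (degree (adj n E) i) <= D * ln (INR n)) ->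
  let Q := 8 * INR K * D ^ 2 * C2 / (eps ^ 2 * C1) in
  let M := 2 * (C2 / C1) * (INR K + 2 * Q * (C2 / C1)) in
  good_graph ((2 * M + C2 / C1 * INR K) / eps) C1 C2 K n E.
Proof.
move=> C10 C12 e0 D0 K1 n2; set L := ln _ => L0 exp deg Q M.
have b0 : 0 < eps * L by apply: Rmult_lt_0_compat.
have DL0 : 0 < D * L by apply: Rmult_lt_0_compat.
have con := expanding_connected (@adj_sym n E) b0 exp.
split=> // c x pv V c_sym c_bnd x_inj pv01 [Vx Vharm] i iB.
pose B := [set x k | k in 'I_K].
have inB j : j \notin B -> forall k, x k <> j.
  by move=> /imsetP jB k xk; apply: jB; exists k.
have iNB : i \notin B by apply/imsetP => -[k _ /esym]; apply: iB.
have cardB : #|B| = K by rewrite card_imset ?card_ord.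
have B0 : B != set0 by rewrite -card_gt0 cardB.
have Vh : harmonic (adj n E) c B V by move=> j /inB; apply: Vharm.
have Vle1 : forall j, V j <= 1.
  apply: (max_principle (@adj_sym n E) c_sym C10 c_bnd Vh con B0).
  by move=> j /imsetP[k _ ->]; rewrite Vx; have := pv01 k; lra.
have Vge0 : forall j, 0 <= V j.
  have h : harmonic (adj n E) c B (fun j => - V j).
    by move=> j jB; rewrite currentN Vh // Ropp_0.
  suff : forall j, - V j <= 0 by move=> h' j; have := h' j; lra.
  apply: (max_principle (@adj_sym n E) c_sym C10 c_bnd h con B0).
  by move=> j /imsetP[k _ ->]; rewrite Vx; have := pv01 k; lra.
have V1 j k : Rabs (V j - V k) <= 1.
  by apply: Rabs_le; have := Vle1 j; have := Vge0 j; have := Vle1 k;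
     have := Vge0 k; lra.
have [a [up down]] := exists_median V i.
(* A median outside [0,1] would have all vertices strictly on one side. *)
have a01 : 0 <= a <= 1.
  split; apply: Rnot_lt_le => a0.
  - suff eqT : above V a = setT by move: up; rewrite -/(above V a) eqT cardsT card_ord; lia.
    by apply/setP => j; rewrite !inE; apply/RltbP; have := Vge0 j; lra.
  - suff eqT : [set i | Rltb (V i) a] = setT by move: down; rewrite eqT cardsT card_ord; lia.
    by apply/setP => j; rewrite !inE; apply/RltbP; have := Vle1 j; lra.
have Va1 j : Rabs (V j - a) <= 1.
  by apply: Rabs_le; have := Vle1 j; have := Vge0 j; lra.
have down' : (2 * #|above (fun i => - V i) (Ropp a)| <= #|{: 'I_n}|)%N.
  suff -> : above (fun i => - V i) (Ropp a) = [set i | Rltb (V i) a] by [].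
  by apply/setP => j; rewrite !inE; apply/RltbP/RltbP; lra.
have degb j : eps * L <= INR (degree (adj n E) j) <= D * L.
  by split => //; apply: expanding_degree => //; rewrite card_ord.
have nc := near_constant (@adj_sym n E) c_sym C10 c_bnd b0 DL0 exp degb C12 Vh B0
  V1 Va1 up down'.
rewrite cardB /= in nc.
have K0 : 0 < INR K by apply/lt_0_INR/ltP.
have {}nc j : j \notin B -> Rabs (V j - a) <= M / (eps * L).
  move=> /nc le1; apply: Rle_trans le1 _; apply: Req_le; rewrite /M /Q.
  by field; repeat split; lra.
have Q0 : 0 < Q.
  apply: Rdiv_lt_0_compat; last by apply: Rmult_lt_0_compat => //; nra.
  by repeat apply: Rmult_lt_0_compat => //; lra.
have C21 : 0 < C2 / C1 by apply: Rdiv_lt_0_compat; lra.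
have M0 : 0 < M by rewrite /M; apply: Rmult_lt_0_compat; nra.
have MbL : 0 <= M / (eps * L) by apply/Rlt_le/Rdiv_lt_0_compat.
have := boundary_average (@adj_sym n E) c_sym C10 c_bnd b0
  (fun j => proj1 (degb j)) C12 Vh B0 Va1 MbL nc.
rewrite cardB !big_imset /=; try by move=> j k _ _; apply: x_inj.
have -> : \big[Rplus/0]_(k in 'I_K) (V (x k) * conductance (adj n E) c (x k))
   = \big[Rplus/0]_(k : 'I_K) (pv k * ctot n E c (x k)).
  by apply: eq_bigr => k _; rewrite Vx.
set av := (_ / _) => le1; have le2 := nc i iNB.
have := Rabs_triang (V i - a) (a - av); rewrite (Rabs_minus_sym a).
have -> : V i - a + (a - av) = V i - av by lra.
have <- : M / (eps * L) + (C2 / C1 * INR K / (eps * L) + M / (eps * L))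
   = (2 * M + C2 / C1 * INR K) / eps / L by field; lra.
by lra.
Qed.

(** * Generating functions and counts of crossing edges *)

Lemma binomial_genfun (T : finType) (U F : {set T}) (p z : R) : F \subset U ->
  \big[Rplus/0]_(E : {set T} | E \subset U)
     (p ^ #|E| * (1 - p) ^ (#|U| - #|E|)%N * z ^ #|E :&: F|)
  = (1 - p + p * z) ^ #|F|.
Proof.
move=> FU.
(* Weights of a present and an absent edge. Outside [U] they are 0 and 1, so expanding the product
   over [T] keeps only subsets of [U]. *)
pose a e := if e \in U then p * (if e \in F then z else 1) else 0.
pose b e := if e \in U then 1 - p else 1.
transitivity (\big[Rmult/1]_(e : T) (a e + b e)); last first.
  have -> : (1 - p + p * z) ^ #|F| = \big[Rmult/1]_(e in F) (1 - p + p * z).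
    by rewrite rprod_const.
  rewrite [RHS]big_mkcond; apply: eq_bigr => e _.
  rewrite /a /b; have [eU|eNU] := boolP (e \in U).
    by case: ifP => _; lra.
  rewrite ifN; first lra.
  by apply: contra eNU; apply: (subsetP FU).
rewrite bigA_distr [RHS](bigID (fun E : {set T} => E \subset U)) /=.
rewrite [X in _ = _ + X]big1 ?Rplus_0_r; last first.
  move=> E /subsetPn [e eE eU]; rewrite (bigD1 e) //= eE /a (negbTE eU).
  by rewrite Rmult_0_l.
apply: eq_bigr => E EU.
transitivity (\big[Rmult/1]_e
   ((if e \in E then p else 1) * (if e \in U :\: E then 1 - p else 1)
     * (if e \in E :&: F then z else 1))).
  rewrite !big_split /= -!big_mkcond !rprod_const cardsD (setIidPr EU).
  by [].
apply: eq_bigr => e _; rewrite /a /b !inE.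
have [eE|eE] := boolP (e \in E); first by rewrite (subsetP EU) //=; case: ifP; lra.
by rewrite /=; case: ifP; lra.
Qed.

(** Serves the union bound twice: with a small [q] for small vertex sets, and with 1 to count all
    vertex sets. *)
Lemma sum_pow_card (T : finType) (q : R) :
  \big[Rplus/0]_(S : {set T}) q ^ #|S| = (1 + q) ^ #|T|.
Proof.
rewrite -(rprod_const (I := T) predT) /=.
under [RHS]eq_bigr => i _ do rewrite Rplus_comm.
rewrite bigA_distr; apply: eq_bigr => S _.
by rewrite -big_mkcond rprod_const.
Qed.

Definition crossing n (S : {set 'I_n}) : {set 'I_n * 'I_n} :=
  [set e in upairs n | (e.1 \in S) != (e.2 \in S)].

(** [cut] orients pairs outward, [E] upward. Sorting the ends is injective on the cut, as only one
    orientation starts in [S]. *)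
Lemma card_cut_adj n (E : {set 'I_n * 'I_n}) (S : {set 'I_n}) :
  E \subset upairs n -> #|cut (adj n E) S| = #|E :&: crossing S|.
Proof.
move=> EU; have Elt i j : (i, j) \in E -> (i < j)%N.
  by move/(subsetP EU); rewrite inE.
pose f (e : 'I_n * 'I_n) := if (e.1 < e.2)%N then e else (e.2, e.1).
rewrite -(card_in_imset (f := f)); last first.
  move=> [i j] [k l]; rewrite !inE /= => /and3P[iS jS _] /and3P[kS lS _].
  rewrite /f /=; case: ifP => _; case: ifP => _ [e1 e2]; subst => //.
  - by rewrite kS in jS.
  - by rewrite iS in lS.
apply: eq_card => -[i j]; apply/imsetP/idP.
- case=> -[k l]; rewrite !inE /= /f /adj => /and3P[kS lS kl].
  case/orP: (kl) => klE.
  + rewrite (Elt _ _ klE) => -[-> ->]; rewrite klE (Elt _ _ klE) kS (negbTE lS).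
    by [].
  + rewrite ltnNge (ltnW (Elt _ _ klE)) /= => -[-> ->].
    by rewrite klE (Elt _ _ klE) kS (negbTE lS).
- rewrite !inE /= => /and3P[ijE lt_ij ijS].
  have [iS|iS] := boolP (i \in S); rewrite ?iS ?(negbTE iS) in ijS.
  + exists (i, j); last by rewrite /f /= lt_ij.
    by rewrite inE /= iS /adj ijE andbT; case: (j \in S) ijS.
  + exists (j, i); last by rewrite /f /= ltnNge (ltnW lt_ij).
    by rewrite inE /= iS /adj ijE orbT andbT; case: (j \in S) ijS.
Qed.

Lemma card_crossing n (S : {set 'I_n}) : #|crossing S| = (#|S| * (n - #|S|))%N.
Proof.
have := card_cut_adj S (subxx (upairs n)).
rewrite (setIidPr _); last by apply/subsetP => e; rewrite inE => /andP[].
move=> <-; have -> : (n - #|S|)%N = #|~: S| by have := cardsC S; rewrite card_ord; lia.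
rewrite -cardsX; apply: eq_card => -[i j]; rewrite !inE /= /adj !inE /=.
case iS: (i \in S) => //=; case jS: (j \in S) => //=.
rewrite -neq_ltn; apply/negP => /eqP /val_inj ij.
by rewrite ij jS in iS.
Qed.

(** * Expectation over G(n,p) and exponential tail bounds *)

Lemma exp_nondecreasing x y : x <= y -> exp x <= exp y.
Proof. by case=> [/exp_increasing/Rlt_le|->]; [|apply: Rle_refl]. Qed.

Lemma exp_pow x m : exp x ^ m = exp (INR m * x).
Proof.
elim: m => [|m IH]; first by rewrite Rmult_0_l exp_0.
by rewrite S_INR /= IH -exp_plus; congr exp; lra.
Qed.

(** Expectation over the random edge set; [Gnp_prob] is by definition the case of an indicator. *)
Definition Gexp n p (f : {set 'I_n * 'I_n} -> R) : R :=
  \big[Rplus/0]_(E : {set 'I_n * 'I_n} | E \subset upairs n)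
     (p ^ #|E| * (1 - p) ^ (#|upairs n| - #|E|)%N * f E).

Lemma Gexp_le n p (f g : {set 'I_n * 'I_n} -> R) : 0 <= p <= 1 ->
  (forall E : {set 'I_n * 'I_n}, E \subset upairs n -> f E <= g E) -> Gexp p f <= Gexp p g.
Proof.
move=> p01 fg; apply: rsum_le => E EU; apply: Rmult_le_compat_l (fg E EU).
by apply: Rmult_le_pos; apply: pow_le; lra.
Qed.

Lemma GexpZ n p a (f : {set 'I_n * 'I_n} -> R) :
  Gexp p (fun E => a * f E) = a * Gexp p f.
Proof. by rewrite /Gexp big_distrr; apply: eq_bigr => E _ /=; lra. Qed.

Lemma Gexp_sum n p (I : finType) (Q : pred I) (f : I -> {set 'I_n * 'I_n} -> R) :
  Gexp p (fun E => \big[Rplus/0]_(i | Q i) f i E)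
    = \big[Rplus/0]_(i | Q i) Gexp p (f i).
Proof.
by rewrite /Gexp exchange_big; apply: eq_bigr => E _; rewrite big_distrr.
Qed.

Lemma GexpD n p (f g : {set 'I_n * 'I_n} -> R) :
  Gexp p (fun E => f E + g E) = Gexp p f + Gexp p g.
Proof. by rewrite /Gexp -big_split; apply: eq_bigr => E _ /=; lra. Qed.

Lemma Gexp1 n p : Gexp (n := n) p (fun=> 1) = 1.
Proof.
have := binomial_genfun p 1 (sub0set (upairs n)).
rewrite cards0 => sum1; rewrite -[RHS]sum1; apply: eq_bigr => E _.
by rewrite setI0 cards0.
Qed.

Lemma ind_le1 (P : Prop) : 0 <= Defs.ind P <= 1.
Proof. by rewrite /Defs.ind; case: (excluded_middle_informative P) => ? /=; lra. Qed.

Lemma indT (P : Prop) : P -> Defs.ind P = 1.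
Proof. by rewrite /Defs.ind; case: (excluded_middle_informative P). Qed.

Lemma Gnp_prob_le1 n p P : 0 <= p <= 1 -> Gnp_prob n p P <= 1.
Proof.
move=> p01; rewrite -(Gexp1 n p); apply: Gexp_le => // E _.
by have := ind_le1 (P E); lra.
Qed.

(* Exponential Markov inequality: upper tails for [lam < 0], lower tails for
   [lam > 0]. *)
Lemma cut_tail n p lam t (S : {set 'I_n}) (P : {set 'I_n * 'I_n} -> Prop) :
  0 <= p <= 1 ->
  (forall E, P E -> 0 <= lam * (t - INR #|cut (adj n E) S|)) ->
  Gnp_prob n p P
    <= exp (lam * t - p * (1 - exp (- lam)) * INR (#|S| * (n - #|S|))%N).
Proof.
move=> p01 Pt.
apply: (Rle_trans _ (Gexp p (fun E => exp (lam * t) *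
   exp (- lam) ^ #|E :&: crossing S|))).
  apply: Gexp_le => // E EU; rewrite exp_pow -exp_plus -card_cut_adj //.
  rewrite /Defs.ind; case: (excluded_middle_informative (P E)) => [Pe|nPE] /=.
    rewrite -exp_0; apply: exp_nondecreasing; have := Pt E Pe.
    by move: (INR _) => X; lra.
  exact/Rlt_le/exp_pos.
rewrite GexpZ /Gexp binomial_genfun; last first.
  by apply/subsetP => e; rewrite inE => /andP[].
rewrite card_crossing /Rminus exp_plus; apply: Rmult_le_compat_l.
  exact/Rlt_le/exp_pos.
have z0 := exp_pos (- lam).
(* With z = exp (- lam), the base 1 - p (1 - z) is at most exp (- p (1 - z)). *)
have -> : - (p * (1 + - exp (- lam)) * INR (#|S| * (n - #|S|))%N)
  = INR (#|S| * (n - #|S|))%N * (- (p * (1 - exp (- lam)))) by lra.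
rewrite -exp_pow; apply: pow_incr; split; first by nra.
by have := exp_ineq1_le (- (p * (1 - exp (- lam)))); lra.
Qed.

Lemma exp_neg_le x : 0 < x -> exp (- x) <= / x.
Proof.
move=> x0; rewrite exp_Ropp; apply: Rinv_le_contravar => //.
by have := exp_ineq1_le x; lra.
Qed.

(** As s/N <= kap, the factor alpha (1 - kap) (1 - s/N) is at least alpha (1 - 2 kap) = 1 + 2 gam.
    One gam pays for the first term; the remaining 1 + gam beats n choices per vertex. *)
Lemma small_set_exponent alpha kap gam L N s :
  alpha = 1 + 4 * gam -> alpha * kap = gam -> 0 < gam -> 0 < kap < 1 ->
  0 < N -> 0 <= L -> 0 <= s <= kap * N ->
  gam * L * s - alpha * L / N * (1 - kap) * (s * (N - s)) <= s * (- (1 + gam) * L).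
Proof.
move=> ag ak g0 k01 N0 L0 s01.
have -> : alpha * L / N * (1 - kap) * (s * (N - s))
  = (L * s) * (alpha * (1 - kap) * (1 - s / N)) by field; lra.
have sN : s / N <= kap.
  by apply: (Rmult_le_reg_r N) => //; rewrite /Rdiv Rmult_assoc Rinv_l; lra.
have le1 : 1 + 2 * gam <= alpha * (1 - kap) * (1 - s / N).
  apply: (Rle_trans _ (alpha * (1 - kap) * (1 - kap))); first by nra.
  by apply: Rmult_le_compat_l; [nra | lra].
have Ls : 0 <= L * s by apply: Rmult_le_pos; lra.
by have := Rmult_le_compat_l _ _ _ Ls le1; lra.
Qed.

(** Now 1 - s/N >= 1/2, so the factor is at least (1 + 3 gam)/2 >= gam + 1/2. The spare 1/2 yields
    decay exponential in N L, enough against 2^n sets. *)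
Lemma large_set_exponent alpha kap gam L N s :
  alpha = 1 + 4 * gam -> alpha * kap = gam -> 0 < gam -> 0 < kap < 1 ->
  0 < N -> 0 <= L -> kap * N <= s -> 2 * s <= N ->
  gam * L * s - alpha * L / N * (1 - kap) * (s * (N - s)) <= N * - (kap / 2 * L).
Proof.
move=> ag ak g0 k01 N0 L0 s0 s1.
have s_pos : 0 < s by nra.
have -> : alpha * L / N * (1 - kap) * (s * (N - s))
  = (L * s) * (alpha * (1 - kap) * (1 - s / N)) by field; lra.
have sN : s / N <= / 2.
  by apply: (Rmult_le_reg_r N) => //; rewrite /Rdiv Rmult_assoc Rinv_l; lra.
have le1 : gam + / 2 <= alpha * (1 - kap) * (1 - s / N).
  apply: (Rle_trans _ (alpha * (1 - kap) * / 2)); first by nra.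
  by apply: Rmult_le_compat_l; [nra | lra].
have Ls : 0 <= L * s by apply: Rmult_le_pos; lra.
have := Rmult_le_compat_l _ _ _ Ls le1.
have : L * (kap * N) <= L * s by apply: Rmult_le_compat_l.
by lra.
Qed.

Lemma exp_sub1_le x : 0 <= x <= / 2 -> exp x - 1 <= 2 * x.
Proof.
move=> x01; have := exp_ineq1_le (- x); have := exp_pos x.
by have := Rinv_r (exp x); rewrite exp_Ropp; nra.
Qed.

Lemma ln_le0 x : x <= 0 -> ln x = 0.
Proof. by move=> x0; rewrite /ln; case: (Rlt_dec 0 x) => // x1; exfalso; lra. Qed.

Lemma pow_le_self y m : 0 <= y <= 1 -> (0 < m)%N -> y ^ m <= y.
Proof.
case: m => // m y01 _ /=; have := pow_incr y 1 m y01; rewrite pow1.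
by have := pow_le y m (proj1 y01); nra.
Qed.

(** * Expansion and degree bounds with high probability *)

Definition expander_graph n (eps D : R) (E : {set 'I_n * 'I_n}) : Prop :=
  expanding (adj n E) (eps * ln (INR n)) /\
  (forall i, INR (degree (adj n E) i) <= D * ln (INR n)).

Lemma degree_cut n (E : {set 'I_n * 'I_n}) i :
  E \subset upairs n -> degree (adj n E) i = #|cut (adj n E) [set i]|.
Proof.
move=> EU; rewrite /degree -(card_imset [pred j | adj n E i j] (f := fun j => (i, j))); last first.
  by move=> j k [].
apply: eq_card => -[k j]; apply/imsetP/idP.
- case=> l; rewrite !inE => il [-> ->]; rewrite eqxx il /= andbT.
  apply: contraTneq il => ->; rewrite /adj orbb.
  by apply/negP => /(subsetP EU); rewrite inE ltnn.
- by rewrite !inE /= => /and3P[/eqP-> _ ij]; exists j.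
Qed.

(** For every edge set some indicator on the right is 1. Degrees are written as cuts of singletons,
    so that [cut_tail] covers both kinds of failure. *)
Lemma expander_graph_union_bound n p eps D : 0 <= p <= 1 ->
  1 <= Gnp_prob n p (expander_graph eps D)
    + \big[Rplus/0]_(S : {set 'I_n} | (S != set0) && (2 * #|S| <= n)%N)
        Gnp_prob n p (fun E => INR #|cut (adj n E) S| < eps * ln (INR n) * INR #|S|)
    + \big[Rplus/0]_(i : 'I_n)
        Gnp_prob n p (fun E => D * ln (INR n) < INR #|cut (adj n E) [set i]|).
Proof.
move=> p01; rewrite -{1}(Gexp1 n p) -!Gexp_sum -!GexpD; apply: Gexp_le => // E EU.
pose Q (S : {set 'I_n}) := (S != set0) && (2 * #|S| <= n)%N.
set b := eps * ln (INR n); set d := D * ln (INR n).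
set s1 := \big[Rplus/0]_(S : {set 'I_n} | _) _; set s2 := \big[Rplus/0]_(i : 'I_n) _.
have s10 : 0 <= s1.
  by apply: rsum_ge0 => S _; case: (ind_le1 (INR #|cut (adj n E) S| < b * INR #|S|)).
have s20 : 0 <= s2.
  by apply: rsum_ge0 => i _; case: (ind_le1 (d < INR #|cut (adj n E) [set i]|)).
have g0 := ind_le1 (expander_graph eps D E).
have [exS|nS] := excluded_middle_informative
  (exists2 S : {set 'I_n}, Q S & INR #|cut (adj n E) S| < b * INR #|S|).
  have [S QS bS] := exS.
  have : 1 <= s1; last by lra.
  rewrite -(indT bS).
  apply: (@rsum_ge_term _ Q (fun S => Defs.ind (INR #|cut (adj n E) S| < b * INR #|S|))) => // U _.
  by case: (ind_le1 (INR #|cut (adj n E) U| < b * INR #|U|)).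
have [exi|ni] := excluded_middle_informative
  (exists i : 'I_n, d < INR #|cut (adj n E) [set i]|).
  have [i di] := exi.
  have : 1 <= s2; last by lra.
  rewrite -(indT di).
  apply: (@rsum_ge_term _ predT (fun i => Defs.ind (d < INR #|cut (adj n E) [set i]|))) => // j _.
  by case: (ind_le1 (d < INR #|cut (adj n E) [set j]|)).
have /indT -> : expander_graph eps D E; last by lra.
split.
- move=> S S0 S2; apply: Rnot_lt_le => lt; apply: nS; exists S => //.
  by rewrite /Q S0 /=; rewrite card_ord in S2.
- by move=> i; rewrite degree_cut //; apply: Rnot_lt_le => lt; apply: ni; exists i.
Qed.

(** [Y] adds up the constants of three failure terms (small sets, large sets, degrees), each relaxed
    to a multiple of 1/L. *)
Lemma expander_graph_prob alpha : 1 < alpha ->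
  exists eps D Y L0, 0 < eps /\ 0 < D /\ 0 < L0 /\
    forall n, L0 <= ln (INR n) ->
      0 <= alpha * ln (INR n) / INR n <= 1 /\
      1 - Y / ln (INR n)
        <= Gnp_prob n (alpha * ln (INR n) / INR n) (expander_graph eps D).
Proof.
move=> a1.
(* The surplus of [alpha] over 1 is cut in four: two shares are lost to [kap], one goes into the
   tail exponent, one is left. *)
pose gam := (alpha - 1) / 4; pose kap := gam / alpha.
have ag : alpha = 1 + 4 * gam by rewrite /gam; field.
have g0 : 0 < gam by rewrite /gam; lra.
have ak : alpha * kap = gam by rewrite /kap; field; lra.
have k0 : 0 < kap by apply: Rdiv_lt_0_compat; lra.
have k1 : kap < 1 by nra.
have lk : ln kap < 0 by rewrite -ln_1; apply: ln_increasing.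
(* Then [exp (- lam) = kap], and [eps = gam / lam] turns [lam * t] into gam L |S|. *)
pose lam := - ln kap.
have lam0 : 0 < lam by rewrite /lam; lra.
have e0 : 0 < gam / lam by apply: Rdiv_lt_0_compat.
have D0 : 0 < 2 + 2 * alpha by lra.
(* [4 * alpha] ensures p <= 1; [2 / gam] and [4 / kap] make [gam * L] and [kap / 2 * L] at least
   2. *)
pose L0 := 1 + 4 * alpha + 2 / gam + 4 / kap.
have ig : 0 < 2 / gam by apply: Rdiv_lt_0_compat; lra.
have ik : 0 < 4 / kap by apply: Rdiv_lt_0_compat; lra.
exists (gam / lam), (2 + 2 * alpha), (2 / gam + 4 / kap + 1), L0.
split=> //; split=> //; split; first by rewrite /L0; lra.
move=> n; set L := ln (INR n) => LL0.
have Lp : 0 < L by rewrite /L0 in LL0; lra.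
have n0 : (0 < n)%N.
  rewrite lt0n; apply/eqP => n_eq0; move: Lp.
  by rewrite /L n_eq0 ln_le0 /=; lra.
have N0 : 0 < INR n by apply/lt_0_INR/ltP.
have expL : exp L = INR n by apply: exp_ln.
have p01 : 0 <= alpha * L / INR n <= 1.
  split; first by apply/Rlt_le/Rdiv_lt_0_compat => //; apply: Rmult_lt_0_compat; lra.
  apply: (Rmult_le_reg_r (INR n)) => //.
  have -> : alpha * L / INR n * INR n = alpha * L by field; lra.
  have -> : 1 * INR n = exp (L / 2) * exp (L / 2).
    by rewrite Rmult_1_l -expL -exp_plus; congr exp; lra.
  have := exp_ineq1_le (L / 2); have : 4 * alpha <= L by rewrite /L0 in LL0; lra.
  by nra.
split=> //.
have := expander_graph_union_bound n (gam / lam) (2 + 2 * alpha) p01.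
rewrite -/L; set p := alpha * L / INR n in p01 *.
set q := exp (- (1 + gam) * L); set r := exp (- (kap / 2 * L)).
have q0 : 0 < q by apply: exp_pos.
have r0 : 0 < r by apply: exp_pos.
have cutS : \big[Rplus/0]_(S : {set 'I_n} | (S != set0) && (2 * #|S| <= n)%N)
    Gnp_prob n p (fun E => INR #|cut (adj n E) S| < gam / lam * L * INR #|S|)
    <= ((1 + q) ^ n - 1) + (2 * r) ^ n.
  (* Charging every set both bounds avoids splitting the sum by size. *)
  apply: (Rle_trans _ (\big[Rplus/0]_(S : {set 'I_n} | S != set0) (q ^ #|S| + r ^ n))).
    apply: (Rle_trans _ (\big[Rplus/0]_(S : {set 'I_n} | (S != set0) && (2 * #|S| <= n)%N)
       (q ^ #|S| + r ^ n))); last first.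
      apply: rsum_sub_le => [S /andP[]//|S _].
      by have := pow_lt _ #|S| q0; have := pow_lt _ n r0; lra.
    apply: rsum_le => S /andP[S0 S2].
    apply: Rle_trans (@cut_tail n p lam _ S _ p01 _) _.
      move=> E lt; apply: Rmult_le_pos; [lra | exact: (Rlt_le _ _ (Rlt_Rminus _ _ lt))].
    have Sn : (#|S| <= n)%N by lia.
    have S2R : 2 * INR #|S| <= INR n by have /leP/le_INR := S2; rewrite mult_INR /=; lra.
    rewrite mult_INR minus_INR; last exact/leP.
    have -> : exp (- lam) = kap by rewrite /lam Ropp_involutive exp_ln.
    have -> : lam * (gam / lam * L * INR #|S|) = gam * L * INR #|S| by field; lra.
    have s0 : 0 <= INR #|S| by apply: pos_INR.
    rewrite /q /r !exp_pow.
    have [small|/Rlt_le large] := Rle_lt_dec (INR #|S|) (kap * INR n).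
    - have /exp_nondecreasing := small_set_exponent ag ak g0 (conj k0 k1) N0
        (Rlt_le _ _ Lp) (conj s0 small).
      have := exp_pos (INR n * - (kap / 2 * L)).
      by rewrite -/p; lra.
    - have /exp_nondecreasing := large_set_exponent ag ak g0 (conj k0 k1) N0
        (Rlt_le _ _ Lp) large S2R.
      have := exp_pos (INR #|S| * (- (1 + gam) * L)).
      by rewrite -/p; lra.
  have := sum_pow_card 'I_n q; rewrite (bigD1 set0) //= cards0 card_ord /=.
  move=> sumq; rewrite big_split /=.
  have : \big[Rplus/0]_(S : {set 'I_n} | S != set0) r ^ n <= (2 * r) ^ n.
    apply: (Rle_trans _ (\big[Rplus/0]_(S : {set 'I_n}) r ^ n)).
      by apply: rsum_sub_le => // S _; apply/Rlt_le/pow_lt.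
    have := sum_pow_card 'I_n 1; rewrite card_ord Rpow_mult_distr => <-.
    rewrite big_distrl /=; apply: rsum_le => S _.
    by rewrite pow1 Rmult_1_l; apply: Rle_refl.
  apply: Rplus_le_compat; apply: Req_le; apply: (Rplus_eq_reg_l 1).
  by apply: etrans sumq _; lra.
have degS : \big[Rplus/0]_(i : 'I_n)
    Gnp_prob n p (fun E => (2 + 2 * alpha) * L < INR #|cut (adj n E) [set i]|)
    <= exp (- L).
  have -> : exp (- L) = INR n * exp (- (2 * L)).
    by rewrite -expL -exp_plus; congr exp; lra.
  rewrite -[n in INR n * _]card_ord -rsum_const; apply: rsum_le => i _.
  (* With [lam = -1] the exponent is at most -(2 + 2 alpha) L + (e - 1) alpha L <= -2 L, as e <=
     3. *)
  apply: Rle_trans (@cut_tail n p (-1) ((2 + 2 * alpha) * L) [set i] _ p01 _) _.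
    by move=> E lt; lra.
  apply: exp_nondecreasing; rewrite cards1 mul1n.
  have -> : - -1 = 1 by lra.
  have np : p * INR (n - 1) <= alpha * L.
    have -> : alpha * L = p * INR n by rewrite /p; field; lra.
    by apply: Rmult_le_compat_l; [lra | apply/le_INR/leP; lia].
  have e3 : exp 1 - 1 <= 2 by have := exp_le_3; lra.
  have y0 : 0 <= p * INR (n - 1) by apply: Rmult_le_pos; [lra | apply: pos_INR].
  by have := Rmult_le_compat_l _ _ _ y0 e3; lra.
have q_le : (1 + q) ^ n - 1 <= 2 / gam / L.
  (* Here n q = n^-gam, and (1 + q)^n <= exp (n q). *)
  have nq : INR n * q = exp (- (gam * L)).
    by rewrite /q -expL -exp_plus; congr exp; lra.
  have gL : 0 < gam * L by apply: Rmult_lt_0_compat.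
  have x_le := exp_neg_le gL; set x := exp (- (gam * L)) in nq x_le.
  have x0 : 0 < x by apply: exp_pos.
  have gL2 : 2 <= gam * L.
    have : gam * (2 / gam) <= gam * L by apply: Rmult_le_compat_l; rewrite /L0 in LL0; lra.
    by have -> : gam * (2 / gam) = 2 by field; lra.
  have x2 : x <= / 2 by apply: Rle_trans x_le _; apply: Rinv_le_contravar; lra.
  have := exp_sub1_le (conj (Rlt_le _ _ x0) x2).
  have : (1 + q) ^ n <= exp x.
    rewrite -nq -exp_pow; apply: pow_incr; split; first lra.
    exact: exp_ineq1_le.
  have -> : 2 / gam / L = 2 * / (gam * L) by field; lra.
  by lra.
have r_le : (2 * r) ^ n <= 4 / kap / L.
  have kL : 0 < kap / 2 * L by apply: Rmult_lt_0_compat => //; lra.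
  have := exp_neg_le kL; rewrite -/r => r_le.
  have kL2 : 2 <= kap / 2 * L.
    have : kap / 2 * (4 / kap) <= kap / 2 * L.
      by apply: Rmult_le_compat_l; rewrite /L0 in LL0; lra.
    by have -> : kap / 2 * (4 / kap) = 2 by field; lra.
  have r2 : r <= / 2 by apply: Rle_trans r_le _; apply: Rinv_le_contravar; lra.
  (* Since 0 <= 2 r <= 1, the power is at most 2 r, already O(1/L). *)
  apply: Rle_trans (pow_le_self _ n0) _; first by lra.
  have -> : 4 / kap / L = 2 * / (kap / 2 * L) by field; lra.
  by lra.
have := exp_neg_le Lp.
have -> : (2 / gam + 4 / kap + 1) / L = 2 / gam / L + 4 / kap / L + / L by field; lra.
by lra.
Qed.

(** * Passage to the limit in n *)

Theorem theorem1p1 (alpha C1 C2 : R) (K : nat) :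
  (1 < alpha) -> (0 < C1) -> (C1 <= C2) -> (1 <= K)%N ->
  exists Cst : R, (0 < Cst) /\
    Un_cv (fun n : nat =>
             Gnp_prob n (alpha * ln (INR n) / INR n) (good_graph Cst C1 C2 K n))
          1.
Proof.
move=> a1 C10 C12 K1.
have [eps [D [Y [L0 [e0 [D0 [L00 prob]]]]]]] := expander_graph_prob a1.
set Q := 8 * INR K * D ^ 2 * C2 / (eps ^ 2 * C1).
set M := 2 * (C2 / C1) * (INR K + 2 * Q * (C2 / C1)).
exists ((2 * M + C2 / C1 * INR K) / eps); split.
  have K0 : 0 < INR K by apply/lt_0_INR/ltP.
  have C21 : 0 < C2 / C1 by apply: Rdiv_lt_0_compat; lra.
  have Q0 : 0 < Q.
    apply: Rdiv_lt_0_compat; last by apply: Rmult_lt_0_compat => //; nra.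
    by repeat apply: Rmult_lt_0_compat => //; lra.
  have M0 : 0 < M by rewrite /M; apply: Rmult_lt_0_compat; nra.
  by apply: Rdiv_lt_0_compat => //; nra.
move=> del del0.
(* [L0] activates the probability bound and [Rabs Y / del] pushes its error below [del]; as [X] is
   positive, n <= 1 is excluded, where [ln (INR n)] is 0. *)
pose X := L0 + 1 + Rabs Y / del.
have [N XN] := INR_unbounded (exp X).
exists N => n nN.
have eX : exp X < INR n by apply: Rlt_le_trans XN _; apply: le_INR.
have LX : X < ln (INR n) by rewrite -(ln_exp X); apply: ln_increasing => //; apply: exp_pos.
have Yd : 0 <= Rabs Y / del.
  by apply: Rmult_le_pos; [apply: Rabs_pos | apply/Rlt_le/Rinv_0_lt_compat].
have L0n : L0 <= ln (INR n) by rewrite /X in LX; lra.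
have [p01 lower] := prob n L0n.
have n2 : (2 <= n)%N.
  case: n LX {L0n p01 lower nN eX} => [|[|//]] /=; last by rewrite ln_1 /X; lra.
  by rewrite ln_le0 /X; lra.
have Ln0 : 0 < ln (INR n) by lra.
have Y_small : Y / ln (INR n) < del.
  apply: (Rmult_lt_reg_r (ln (INR n))) => //.
  have -> : Y / ln (INR n) * ln (INR n) = Y by field; lra.
  have : del * (Rabs Y / del) < del * ln (INR n).
    by apply: Rmult_lt_compat_l => //; rewrite /X in LX; lra.
  have -> : del * (Rabs Y / del) = Rabs Y by field; lra.
  by have := Rle_abs Y; lra.
have le1 := Gnp_prob_le1 (good_graph ((2 * M + C2 / C1 * INR K) / eps) C1 C2 K n) p01.
have ge1 : Gnp_prob n (alpha * ln (INR n) / INR n) (expander_graph eps D)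
   <= Gnp_prob n (alpha * ln (INR n) / INR n)
        (good_graph ((2 * M + C2 / C1 * INR K) / eps) C1 C2 K n).
  apply: Gexp_le => // E _.
  have [[exp deg]|nE] := excluded_middle_informative (expander_graph eps D E).
    by rewrite !indT //; [apply: Rle_refl | apply: expander_good_graph].
  rewrite {1}/Defs.ind; case: excluded_middle_informative => // ? /=.
  by case: (ind_le1 (good_graph ((2 * M + C2 / C1 * INR K) / eps) C1 C2 K n E)).
by rewrite /R_dist Rabs_left1; lra.
Qed.
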